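(* Let the random variable $Y$ have second moment $E(Y^2)=1$ and let its distribution function be concave on $[0,\infty)$ and equal to $0$ on $(-\infty,0)$. For all nonnegative $v$ the inequality $$P(Y\geq v)\leq \begin{cases} 1-\dfrac{v}{\sqrt3}, & 0\leq v\leq \dfrac{2}{\sqrt3},\\[2mm] \dfrac49\,\dfrac{1}{v^2}, & \dfrac{2}{\sqrt3}\leq v,\end{cases}$$ is valid. For $0\leq v\leq 2/\sqrt3$ equality holds if and only if $Y$ has a uniform distribution on $[0,\sqrt3)$. For $2/\sqrt3\leq v$ equality holds if and only if $Y$ has a one-sided boundary-inflated uniform distribution on $[0,3v/2)$ with mass $1-4/(3v^2)$ at $0$.
   Context: A one-sided boundary-inflated uniform distribution is a unimodal distribution that is uniform on its support with an atom at one of the boundary points of the support. In particular, the one-sided boundary-inflated uniform distribution on $[0,c)$ with mass $p_0$ at $0$ is the mixture that puts a point mass $p_0$ at $0$ and distributes the remaining mass $1-p_0$ uniformly on $[0,c)$.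
   Formalization: For 0 ≤ v ≤ 2/√3, ''equality only if Y is uniform on [0,√3)'' is stated for v ≠ 0 only: at v = 0 equality P(Y ≥ 0) = 1 holds for every admissible Y, e.g. the exponential distribution with rate √2, which is not uniform. *)

(* Defs.v *)
From HB Require Import structures.
From mathcomp Require Import all_boot all_order all_algebra.
From mathcomp Require Import all_classical all_reals all_analysis.

Set Implicit Arguments.
Unset Strict Implicit.
Unset Printing Implicit Defensive.

Import Order.TTheory GRing.Theory Num.Theory.
Import numFieldNormedType.Exports.

Local Open Scope classical_set_scope.
Local Open Scope ring_scope.

Definition concave_function (R : numFieldType) (D : set R) (f : R -> R) : Prop :=
  convex_function (D : set (convex_lmodType R^o)) (fun x => - f x).

Section laws.
Context d (T : measurableType d) (R : realType) (P : probability T R).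

(* [uniform_prob] has a density on the closed interval [0, c]; as a measure it
   is also the uniform law on [0, c), since {c} is Lebesgue-negligible. *)
Definition has_uniform_law (Y : {RV P >-> R}) (c : R) : Prop :=
  exists c_gt0 : 0 < c, forall A : set R, measurable A ->
    distribution P Y A = uniform_prob c_gt0 A.

(* The degenerate masses p0 = 0 (plain uniform law) and p0 = 1 are allowed. *)
Definition has_boundary_inflated_uniform_law
    (Y : {RV P >-> R}) (c p0 : R) : Prop :=
  0 <= p0 <= 1 /\
  exists c_gt0 : 0 < c, forall A : set R, measurable A ->
    distribution P Y A =
    (p0%:E * \d_(0 : R)%R A + (1 - p0)%:E * uniform_prob c_gt0 A)%E.

End laws.

(* Main.v *)
Require Import Defs.
From HB Require Import structures.
From mathcomp Require Import all_boot all_order all_algebra.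
From mathcomp Require Import all_classical all_reals all_analysis.
From mathcomp Require Import unstable measurable_realfun ring lra.

Set Implicit Arguments.
Unset Strict Implicit.
Unset Printing Implicit Defensive.

Import Order.TTheory GRing.Theory Num.Theory.
Import numFieldNormedType.Exports.

Local Open Scope classical_set_scope.
Local Open Scope ring_scope.

(** Write [G] for the tail [y |-> P(Y > y)], which is convex and nonincreasing
    on [[0, +oo[].  For [v > 0] there is no atom at [v], so [P(Y >= v) = G v];
    the bounds are positive, so [G v > 0] may be assumed.  A supporting line of
    [G] at [v] is [y |-> a * (1 - y / b)]; it decreases since [G] tends to [0],
    so [b > v], and [a <= 1] since [G 0 <= 1].  Hence [G] lies above the tent
    which is the positive part of that line, and both agree at [v]
    ([supporting_tent]).

    The tent is the tail of the law that puts mass [1 - a] at [0] and spreads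
    [a] uniformly on [[0, b]], whose second moment is [a * b ^+ 2 / 3].  Since
    the second moment of [Y] is the integral of [G (Num.sqrt t)] over
    [t >= 0], comparison of the tails gives [a * b ^+ 2 <= 3]
    ([tent_below_moment]).  The theorem is then the maximisation of
    [a * (1 - v / b)] under [a <= 1], [a * b ^+ 2 <= 3] and [v < b].  For
    [v <= 2 / sqrt 3] both constraints are tight, at [a = 1] and [b = sqrt 3]
    ([tent_value_le_linear]); for larger [v] only the second is, and the
    maximum is at [b = 3 * v / 2] ([tent_value_le_inverse_square]).

    In either case of equality [a * b ^+ 2 = 3], so [G] and the tent below it
    have the same integral, and right continuity makes them equal everywhere
    on [[0, +oo[] ([tent_below_eq]).  As [Y] has no mass on the negative axis,
    its law is the boundary-inflated uniform law with that tent as tail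
    ([boundary_inflated_of_ccdf]). *)

(** * Tents and the extremal problem *)

(** The tail [y |-> P(U > y)], for [0 <= y], of a uniform variable [U] on
    [[0, b]]. *)
Definition tent (R : realType) (b y : R) : R := Num.max 0 (1 - y / b).

Lemma tent_ge0 (R : realType) (b y : R) : 0 <= tent b y.
Proof. by rewrite /tent le_max lexx. Qed.

Lemma tent_nonincreasing (R : realType) (b x y : R) : 0 < b -> x <= y ->
  tent b y <= tent b x.
Proof.
move=> b0 xy; rewrite /tent ge_max le_max lexx/= le_max.
by rewrite lerD2l lerN2 ler_pM2r ?invr_gt0// xy orbT.
Qed.

(** With [x := v * s], the gap when [s < b] is, up to the factor [b ^- 3],
    an affine function of [x] on [[0, 2]]; the coefficients below are its
    values [b * (b ^+ 2 - 3)] at [0] and [(b - s) ^+ 2 * (b + 2 * s) / 3] at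
    [2], both positive.  When [b <= s] neither factor of [a * (1 - v / b)]
    exceeds its value at [a = 1] and [b = s]. *)
Lemma tent_value_le_linear (R : realType) (s a b v : R) :
  0 < s -> s ^+ 2 = 3 -> a <= 1 -> a * b ^+ 2 <= 3 ->
  0 < v -> v < b -> v <= 2 / s ->
  a * (1 - v / b) <= 1 - v / s ?= iff (a == 1) && (b == s).
Proof.
move=> s0 s2 a1 ab v0 vb vs.
have b0 : 0 < b by apply: lt_trans vb.
have vb0 : 0 < 1 - v / b by rewrite subr_gt0 ltr_pdivrMr// mul1r.
have [bs|sb] := leP b s.
  have i : v / s <= v / b by rewrite ler_pM2l// lef_pV2.
  apply/leifP; case: ifPn => [/andP[/eqP-> /eqP->]|]; first by rewrite mul1r.
  rewrite negb_and => /orP[an|bn].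
    have : a * (1 - v / b) < 1 - v / b.
      by rewrite gtr_pMl// lt_neqAle an.
    lra.
  have {}i : v / s < v / b.
    by rewrite ltr_pM2l// ltf_pV2// lt_neqAle bn.
  have : a * (1 - v / b) <= 1 - v / b by rewrite ger_pMl.
  lra.
rewrite (gt_eqF sb) andbF; apply/leifP.
have : a * (1 - v / b) <= 3 / b ^+ 2 * (1 - v / b).
  by rewrite ler_wpM2r ?(ltW vb0)// ler_pdivlMr// exprn_gt0.
move/le_lt_trans; apply; rewrite -subr_gt0.
pose x := v * s.
have x2 : x <= 2 by rewrite -ler_pdivlMr.
have x0 : 0 < x by rewrite mulr_gt0.
have -> : 1 - v / s - 3 / b ^+ 2 * (1 - v / b) =
  ((1 - x / 2) * (b * (b ^+ 2 - 3)) +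
   x / 6 * ((b - s) ^+ 2 * (b + 2 * s))) / b ^+ 3.
  have vE : v = x * s / 3 by rewrite /x -s2; field; rewrite gt_eqF.
  have -> : v / s = x / 3 by rewrite vE; field; rewrite gt_eqF.
  rewrite vE.
  have -> : (b - s) ^+ 2 * (b + 2 * s) =
    b ^+ 3 - 3 * s ^+ 2 * b + 2 * s * s ^+ 2 by ring.
  by rewrite s2; field; rewrite gt_eqF.
rewrite divr_gt0 ?exprn_gt0// ltr_wpDl//.
  rewrite mulr_ge0//; first lra.
  rewrite mulr_ge0 ?(ltW b0)// -s2 subr_ge0 lerXn2r ?nnegrE ?ltW//.
rewrite mulr_gt0//; first lra.
by rewrite mulr_gt0 ?exprn_gt0 ?subr_gt0//; lra.
Qed.

(** The gap splits into the slack of [a * b ^+ 2 <= 3] plus what is left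
    when that constraint is tight; the latter contains the square of
    [2 * b - 3 * v], because [3 * v / 2] maximises [(b - v) / b ^+ 3]. *)
Lemma tent_value_le_inverse_square (R : realType) (a b v : R) :
  a * b ^+ 2 <= 3 -> 0 < v -> v < b ->
  a * (1 - v / b) <= 4 / 9 * (1 / v ^+ 2)
    ?= iff (a * b ^+ 2 == 3) && (b == 3 * v / 2).
Proof.
move=> ab v0 vb.
have b0 : 0 < b by apply: lt_trans vb.
have b20 : 0 < b ^+ 2 by rewrite exprn_gt0.
have vb0 : 0 < 1 - v / b by rewrite subr_gt0 ltr_pdivrMr// mul1r.
pose A := (3 - a * b ^+ 2) * (1 - v / b) / b ^+ 2.
pose B := (2 * b - 3 * v) ^+ 2 * (b + 3 * v) / (9 * v ^+ 2 * b ^+ 3).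
have E : 4 / 9 * (1 / v ^+ 2) = a * (1 - v / b) + A + B.
  by rewrite /A /B; field; rewrite !gt_eqF.
have A0 : 0 <= A.
  by rewrite divr_ge0 ?(ltW b20)// mulr_ge0 ?(ltW vb0)// subr_ge0.
have den : 0 < 9 * v ^+ 2 * b ^+ 3 by rewrite !mulr_gt0 ?exprn_gt0.
have B0 : 0 <= B.
  by rewrite divr_ge0 ?(ltW den)// mulr_ge0 ?sqr_ge0//; lra.
split; first by rewrite E; lra.
have -> : (a * (1 - v / b) == 4 / 9 * (1 / v ^+ 2)) = (A == 0) && (B == 0).
  by rewrite -paddr_eq0// E -addrA -subr_eq0 opprD addNKr oppr_eq0.
have -> : (A == 0) = (a * b ^+ 2 == 3).
  rewrite /A mulf_eq0 mulf_eq0 invr_eq0 (gt_eqF b20) (gt_eqF vb0) !orbF.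
  by rewrite subr_eq0 eq_sym.
have -> : (B == 0) = (b == 3 * v / 2).
  rewrite /B mulf_eq0 mulf_eq0 invr_eq0 (gt_eqF den) orbF sqrf_eq0.
  have -> : (b + 3 * v == 0) = false by apply/gt_eqF; lra.
  by rewrite orbF; apply/eqP/eqP => h; lra.
by [].
Qed.

(** * Convex functions on the half-line *)

Lemma concave_chord (R : realType) (F : R -> R) (x y z : R) :
  concave_function `[0, +oo[ F -> 0 <= x -> x < y -> y < z ->
  (z - y) * F x + (y - x) * F z <= (z - x) * F y.
Proof.
move=> Fc x0 xy yz.
have zx : 0 < z - x by lra.
have z0 : 0 <= z by lra.
pose t := (z - y) / (z - x).
have t01 : 0 <= t <= 1.
  by rewrite /t divr_ge0 ?ler_pdivrMr//=; lra.
have tM : t * (z - x) = z - y by rewrite /t divfK// gt_eqF.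
have t1M : (1 - t) * (z - x) = y - x by rewrite mulrBl tM mul1r; lra.
have -> : z - y = t * (z - x) by [].
have := Fc (@Itv01 R t (andP t01).1 (andP t01).2) x z.
rewrite !inE/= !in_itv/= !andbT => /(_ x0 z0).
rewrite [X in _ <= X -> _](_ : _ = t * - F x + (1 - t) * - F z)//.
rewrite /conv/= /unstable.onem /GRing.scale/=.
have -> : t * x + (1 - t) * z = y.
  have -> : t * x + (1 - t) * z = z - t * (z - x) by ring.
  by rewrite tM; ring.
move=> h.
rewrite -t1M.
have {}h : t * F x + (1 - t) * F z <= F y by move: h; lra.
have := ler_wpM2r (ltW zx) h; rewrite mulrDl; lra.
Qed.

Section convex_tail.
Variables (R : realType) (G : R -> R).
Hypothesis G_chord : forall x y z : R, 0 <= x -> x < y -> y < z ->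
  (z - x) * G y <= (z - y) * G x + (y - x) * G z.

(** The slopes [(G v - G y) / (y - v)] decrease in the position of [y], so
    their supremum over [y > v] is a slope that works on both sides of [v];
    the point [z] makes it positive. *)
Lemma support_line (v z : R) : 0 < v -> v < z -> G z < G v ->
  exists2 m : R, 0 < m & forall y, 0 <= y -> G v - m * (y - v) <= G y.
Proof.
move=> v0 vz Gzv.
pose slope y := (G v - G y) / (y - v).
have slope_ub x y : 0 <= x -> x < v -> v < y -> slope y <= slope x.
  move=> x0 xv vy; have := G_chord x0 xv vy.
  rewrite /slope.
  have -> : (G v - G x) / (x - v) = (G x - G v) / (v - x).
    by rewrite -mulrNN -invrN !opprB.
  rewrite ler_pdivrMr ?subr_gt0// mulrAC ler_pdivlMr ?subr_gt0//; lra.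
pose S := [set slope y | y in [set y | v < y]].
have Sub : has_ubound S.
  by exists (slope 0) => _ [y vy <-]; apply: slope_ub.
have Ssup : has_sup S by split => //; exists (slope z), z.
exists (sup S).
  apply: (@lt_le_trans _ _ (slope z)).
    by rewrite /slope divr_gt0// subr_gt0.
  by apply: ub_le_sup => //; exists z.
move=> y y0; have [yv|vy|->] := ltgtP y v.
- have : sup S <= slope y.
    by apply: ge_sup; [exact: Ssup.1|move=> _ [u vu <-]; exact: slope_ub].
  have -> : slope y = (G y - G v) / (v - y).
    by rewrite /slope -mulrNN -invrN !opprB.
  rewrite ler_pdivlMr ?subr_gt0//; lra.
- have : slope y <= sup S by apply: ub_le_sup => //; exists y.
  rewrite /slope ler_pdivrMr ?subr_gt0//; lra.
- lra.
Qed.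

(** Left continuity at an interior point, in one-sided form: near [v] the
    graph of [G] stays below the chord from [0] to [v]. *)
Lemma convex_left_limit_le (v q : R) : 0 < v -> G 0 <= 1 -> 0 <= G v ->
  (forall y, 0 <= y -> y < v -> q <= G y) -> q <= G v.
Proof.
move=> v0 G0 Gv0 qG; rewrite leNgt; apply/negP => Gvq.
have q1 : q <= 1 by apply: le_trans G0; apply: qG.
(* The chord bounds [G (v - e)] by [G v + e / v]; half of the assumed gap
   [q - G v] is left for [e / v]. *)
pose e := v * ((q - G v) / 2).
have e0 : 0 < e by rewrite mulr_gt0// divr_gt0//; lra.
have ev : e < v by rewrite /e gtr_pMr//; lra.
have ve : 0 < v - e by lra.
have vev : v - e < v by lra.
have := G_chord (lexx 0) ve vev.
have := qG _ (ltW ve) vev.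
rewrite !subr0 opprB addrCA subrr addr0 => /(ler_wpM2l (ltW v0)) qGe.
have : e * G 0 <= e by rewrite ger_pMr.
have : (v - e) * G v <= v * G v by rewrite ler_wpM2r//; lra.
have : e = v * q / 2 - v * G v / 2 by rewrite /e; field.
lra.
Qed.

End convex_tail.

(** * Second moments as integrals of tails *)

(** The second moment of the uniform law on [[0, b]], written as the
    integral of the tail of its square. *)
Lemma integral_tent_sqrt (R : realType) (b : R) : 0 < b ->
  (\int[@lebesgue_measure R]_(t in `[0%R, (b ^+ 2)%R]) (1 - Num.sqrt t / b)%:E
   = (b ^+ 2 / 3)%:E)%E.
Proof.
move=> b0.
have b20 : 0 < b ^+ 2 by rewrite exprn_gt0.
pose F (t : R) := t - (2 / (3 * b)) * (t * Num.sqrt t).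
have Fcont : continuous F.
  move=> t; apply: cvgB; first exact: cvg_id.
  apply: cvgM; first exact: cvg_cst.
  by apply: cvgM; [exact: cvg_id|exact: sqrt_continuous].
have dF (t : R) : 0 < t -> is_derive t 1 F (1 - Num.sqrt t / b).
  move=> t0.
  have ds := is_derive1_sqrt t0.
  have st : Num.sqrt t != 0 by rewrite gt_eqF// sqrtr_gt0.
  apply: is_derive_eq.
  rewrite /GRing.scale/= -[X in X / (2 * _)](sqr_sqrtr (ltW t0)).
  by field; rewrite st gt_eqF.
rewrite (@continuous_FTC2 _ _ F)//.
- rewrite /F !sqrtr_sqr gtr0_norm// -EFinD; congr EFin.
  rewrite mul0r; field; exact: lt0r_neq0.
- apply: continuous_subspaceT => t.
  apply: cvgB; first exact: cvg_cst.
  by apply: cvgM; [exact: sqrt_continuous|exact: cvg_cst].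
- split.
  + move=> t; rewrite in_itv/= => /andP[t0 _].
    by have [] := dF t t0.
  + by apply: cvg_at_right_filter; exact: Fcont.
  + by apply: cvg_at_left_filter; exact: Fcont.
- move=> t; rewrite in_itv/= => /andP[t0 _].
  by rewrite derive1E; have := dF t t0; move=> ?; rewrite derive_val.
Qed.

Lemma measurable_sqrt (R : realType) : measurable_fun setT (@Num.sqrt R).
Proof. exact: continuous_measurable_fun (@sqrt_continuous R). Qed.

(** Only an inequality, since [Y] may take negative values: for [t >= 0],
    [Y > Num.sqrt t] entails [Y ^+ 2 > t]. *)
Lemma expectation_sqr_ge d (T : measurableType d) (R : realType)
    (P : probability T R) (Y : {RV P >-> R}) :
  (\int[@lebesgue_measure R]_(t in `[0%R, +oo[) ccdf Y (Num.sqrt t) <=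
   'E_P[fun w => (Y w ^+ 2)%R])%E.
Proof.
have mY2 : measurable_fun setT (fun w => Y w ^+ 2).
  exact: measurable_funX.
pose Y2 : {RV P >-> R} := mfun_Sub (mem_set mY2).
have -> : (fun w => (Y w ^+ 2)%R) = Y2 by [].
rewrite ge0_expectation_ccdf; last by move=> w; exact: sqr_ge0.
apply: ge0_le_integral => //.
- apply: measurable_funTS; apply: measurableT_comp.
    exact: ccdf_measurable.
  exact: measurable_sqrt.
- apply: measurable_funTS; exact: ccdf_measurable.
- move=> t; rewrite /= in_itv/= andbT => t0.
  rewrite /ccdf/= /distribution/pushforward; apply: le_measure; rewrite ?inE//.
  + exact: measurable_funPTI.
  + exact: measurable_funPTI.
  move=> w /=; rewrite !in_itv/= !andbT => tY.
  rewrite -(sqr_sqrtr t0) ltrXn2r// ?nnegrE ?sqrtr_ge0//.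
Qed.

(** The term in [e] is what a strict excess over the tent contributes; it
    serves to exclude such an excess when the second moment is exhausted. *)
Lemma le_integral_tent_bump (R : realType) (g : R -> \bar R) (a b e t0 t1 : R) :
  0 <= a -> 0 < b -> 0 <= e -> 0 <= t0 -> measurable_fun setT g ->
  (forall t, 0 <= t ->
    ((a * tent b (Num.sqrt t) + e * \1_(`[t0, t1]) t)%:E <= g t)%E) ->
  ((a * (b ^+ 2 / 3) + e * (t1 - t0))%:E <=
    \int[@lebesgue_measure R]_(t in `[0%R, +oo[) g t)%E.
Proof.
move=> a0 b0 e0 t00 mg tg.
pose mu := @lebesgue_measure R.
have mtent : measurable_fun setT (fun t : R => tent b (Num.sqrt t)).
  apply: measurable_maxr; first exact: measurable_cst.
  apply: measurable_funB; first exact: measurable_cst.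
  apply: measurable_funM; last exact: measurable_cst.
  exact: measurable_sqrt.
have tent_int : ((b ^+ 2 / 3)%:E <=
    \int[mu]_(t in `[0%R, +oo[) (tent b (Num.sqrt t))%:E)%E.
  rewrite -integral_tent_sqrt//.
  apply: (@le_trans _ _ (\int[mu]_(t in `[0%R, (b ^+ 2)%R])
      (tent b (Num.sqrt t))%:E)%E).
    rewrite le_eqVlt; apply/orP; left; apply/eqP; apply: eq_integral => t.
    rewrite inE/= in_itv/= => /andP[_ tb]; congr EFin.
    rewrite /tent max_r// subr_ge0 ler_pdivrMr// mul1r.
    by rewrite -(ger0_norm (ltW b0)) -sqrtr_sqr ler_wsqrtr.
  apply: ge0_subset_integral => //.
  - exact/measurable_EFinP/measurable_funTS.
  - by move=> t _; rewrite lee_fin tent_ge0.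
  - by move=> t /=; rewrite !in_itv/= andbT => /andP[].
apply: (@le_trans _ _ (\int[mu]_(t in `[0%R, +oo[)
   (a%:E * (tent b (Num.sqrt t))%:E + e%:E * (\1_(`[t0, t1]) t)%:E))%E).
  rewrite ge0_integralD//; last first.
  - by apply/measurable_EFinP/measurable_funTS/measurable_funM.
  - by move=> t _; rewrite -EFinM lee_fin mulr_ge0// indicE ler0n.
  - by apply/measurable_EFinP/measurable_funTS/measurable_funM.
  - by move=> t _; rewrite -EFinM lee_fin mulr_ge0// tent_ge0.
  rewrite ge0_integralZl//; last first.
  - by move=> t _; rewrite lee_fin tent_ge0.
  - exact/measurable_EFinP/measurable_funTS.
  rewrite ge0_integralZl//; last first.
  - exact/measurable_EFinP/measurable_funTS.
  rewrite integral_indic// EFinD !EFinM; apply: leeD.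
    by apply: lee_wpmul2l => //; rewrite lee_fin.
  apply: lee_wpmul2l; first by rewrite lee_fin.
  rewrite setIidl; last first.
    by move=> t /=; rewrite !in_itv/= andbT => /andP[+ _]; exact: le_trans.
  rewrite [X in (_ <= X)%E] lebesgue_measure_itv/= lte_fin.
  case: ifPn => [_|]; first by rewrite EFinB.
  by rewrite -leNgt => ?; rewrite lee_fin; lra.
apply: ge0_le_integral => //.
- move=> t _; rewrite -!EFinM -EFinD lee_fin addr_ge0// mulr_ge0// ?tent_ge0//.
- apply: emeasurable_funD.
  + by apply/measurable_EFinP/measurable_funTS/measurable_funM.
  + by apply/measurable_EFinP/measurable_funTS/measurable_funM.
- exact: measurable_funTS.
- by move=> t; rewrite /= in_itv/= andbT -!EFinM -EFinD; exact: tg.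
Qed.

(** * Uniform laws and their tails *)

Lemma uniform_probE (R : realType) (c : R) (c0 : 0 < c) (A : set R) :
  measurable A ->
  uniform_prob c0 A = ((c^-1)%:E * lebesgue_measure (A `&` `[0%R, c]))%E.
Proof.
move=> mA; rewrite /uniform_prob integral_uniform_pdf.
rewrite (eq_integral (fun=> (c^-1)%:E)).
  by rewrite integral_cst//; exact: measurableI.
move=> x; rewrite inE/= => -[_]; rewrite in_itv/= /uniform_pdf => ->.
by rewrite subr0.
Qed.

Lemma uniform_prob_cy (R : realType) (c : R) (c0 : 0 < c) (v : R) :
  0 <= v -> v <= c -> uniform_prob c0 `[v, +oo[ = (1 - v / c)%:E.
Proof.
move=> v0 vc; rewrite uniform_probE//.
have -> : `[v, +oo[ `&` `[0, c] = `[v, c]%classic :> set R.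
  apply/seteqP; split => x /=; rewrite !in_itv/= ?andbT.
    by move=> [-> /andP[]].
  by move=> /andP[vx ->]; rewrite vx (le_trans v0 vx).
rewrite lebesgue_measure_itv/= lte_fin; case: ifPn => [_|].
  by rewrite -EFinD -EFinM; congr EFin; field; rewrite gt_eqF.
rewrite -leNgt => cv; have -> : v = c by apply/eqP; rewrite eq_le vc.
by rewrite mule0 divff ?gt_eqF// subrr.
Qed.

Lemma uniform_prob_oy (R : realType) (c : R) (c0 : 0 < c) (x : R) :
  uniform_prob c0 `]x, +oo[ = (tent c (Num.max 0 x))%:E.
Proof.
rewrite uniform_probE// /tent.
have [x0|x0] := leP 0 x; last first.
  have -> : `]x, +oo[ `&` `[0, c] = `[0, c]%classic :> set R.
    apply/setIidr => y /=; rewrite !in_itv/= andbT => /andP[y0 _].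
    exact: lt_le_trans x0 y0.
  rewrite lebesgue_measure_itv/= lte_fin c0 mul0r subr0.
  rewrite -EFinD subr0 -EFinM mulVf ?gt_eqF//.
  by rewrite max_r.
have -> : `]x, +oo[ `&` `[0, c] = `]x, c]%classic :> set R.
  apply/seteqP; split => y /=; rewrite !in_itv/= ?andbT.
    by move=> [-> /andP[]].
  by move=> /andP[xy ->]; rewrite xy (le_trans x0 (ltW xy)).
rewrite lebesgue_measure_itv/= lte_fin; case: ifPn => [xc|].
  rewrite max_r ?subr_ge0 ?ler_pdivrMr ?mul1r ?ltW//.
  by rewrite -EFinD -EFinM; congr EFin; field; rewrite gt_eqF.
rewrite -leNgt => cx; rewrite mule0 max_l//.
by rewrite subr_le0 ler_pdivlMr// mul1r.
Qed.

(** The open right rays form a pi-system that generates the Borel sets. *)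
Lemma ccdf_determines_law d (T : measurableType d) (R : realType)
    (P : probability T R) (Y : {RV P >-> R})
    (m : {measure set (measurableTypeR R) -> \bar R}) :
  (forall x, ccdf Y x = m `]x, +oo[%classic) ->
  forall A : set R, measurable A -> distribution P Y A = m A.
Proof.
move=> Ym A mA.
(* The target of a real random variable carries another display than
   [measurableTypeR R], with the same measurable sets. *)
have mY : measurable_fun setT (Y : T -> measurableTypeR R).
  exact: (@measurable_funPT _ _ _ _ Y).
pose Y' : {mfun T >-> measurableTypeR R} :=
  @mfun_Sub _ _ T (measurableTypeR R) Y (mem_set mY).
rewrite -[LHS]/(distribution P Y' A).
have unique := @measure_unique _ R (measurableTypeR R) (@RGenOInfty.G R)
  (fun n => `]- n%:R, +oo[%classic) _ _ _ _ (distribution P Y') m.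
apply: unique => //.
- exact: RGenOInfty.measurableE.
- move=> _ _ [x ->] [y ->]; exists (Num.max x y).
  apply/seteqP; split => z /=; rewrite !in_itv/= !andbT gt_max.
    by move=> [-> ->].
  by move=> /andP[].
- by move=> n; exists (- n%:R).
- apply/seteqP; split => // x _; exists (Num.bound x) => //=.
  by rewrite in_itv/= andbT ltrNl ltrNbound.
- by move=> _ [x ->]; exact: Ym.
- by move=> n; rewrite -ge0_fin_numE// fin_num_measure.
Qed.

Lemma boundary_inflated_of_ccdf d (T : measurableType d) (R : realType)
    (P : probability T R) (Y : {RV P >-> R}) (c p : R) (c0 : 0 < c) :
  0 <= p <= 1 -> (forall x : R, x < 0 -> cdf Y x = 0%E) ->
  (forall x, 0 <= x -> ccdf Y x = (p * tent c x)%:E) ->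
  forall A : set R, measurable A -> distribution P Y A =
    ((1 - p)%:E * \d_(0 : R)%R A + p%:E * uniform_prob c0 A)%E.
Proof.
move=> /andP[p0 p1] Y0 Yc.
have q0 : 0 <= 1 - p by rewrite subr_ge0.
pose m := measure_add
  (mscale (NngNum q0) (@dirac _ (measurableTypeR R) 0 R))
  (mscale (NngNum p0) (uniform_prob c0)).
have mE B : m B = ((1 - p)%:E * \d_(0 : R)%R B + p%:E * uniform_prob c0 B)%E.
  by rewrite /m measure_addE.
move=> A mA; rewrite -mE; apply: ccdf_determines_law mA => x.
rewrite [RHS]mE uniform_prob_oy diracE.
have [x0|x0] := leP 0 x.
  rewrite memNset ?mule0 ?add0e ?Yc//= in_itv/= andbT.
  by apply/negP; rewrite -leNgt.
rewrite mem_set/= ?in_itv/= ?x0// /tent mul0r subr0 max_r//.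
rewrite mule1 mule1 -EFinD subrK.
by rewrite ccdf_1_cdf Y0// sube0.
Qed.

(** * Tents below a convex tail *)

Section tail.
Context d (T : measurableType d) (R : realType) (P : probability T R).
Variable Y : {RV P >-> R}.

Let G (y : R) : R := fine (ccdf Y y).

Lemma ccdf_fineE y : ccdf Y y = (G y)%:E.
Proof. by rewrite /G fineK// fin_num_measure. Qed.

Let G_ge0 y : 0 <= G y.
Proof. by rewrite fine_ge0. Qed.

Let G_le1 y : G y <= 1.
Proof. by rewrite -lee_fin -ccdf_fineE probability_le1. Qed.

Lemma ccdf_chord : concave_function `[0, +oo[ (fun x : R => fine (cdf Y x)) ->
  forall x y z : R, 0 <= x -> x < y -> y < z ->
  (z - x) * fine (ccdf Y y) <=
    (z - y) * fine (ccdf Y x) + (y - x) * fine (ccdf Y z).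
Proof.
move=> Fc x y z x0 xy yz; have := concave_chord Fc x0 xy yz.
have FG u : fine (cdf Y u) = 1 - G u.
  by rewrite cdf_1_ccdf ccdf_fineE.
rewrite !FG -/(G x) -/(G y) -/(G z); nra.
Qed.

Hypothesis Gc : forall x y z : R, 0 <= x -> x < y -> y < z ->
  (z - x) * G y <= (z - y) * G x + (y - x) * G z.

Lemma set_ge_preimage v : [set w | v <= Y w] = Y @^-1` `[v, +oo[%classic.
Proof. by apply/seteqP; split => w /=; rewrite in_itv/= andbT. Qed.

Lemma measurable_ge v : measurable [set w | v <= Y w].
Proof. by rewrite set_ge_preimage; exact: (measurable_funPTI Y). Qed.

(** A function concave on [[0, +oo[] is continuous on [[0, +oo[] except
    possibly at [0], the only place there for an atom. *)
Lemma tail_ccdf v : 0 < v -> P [set w : T | v <= Y w] = ccdf Y v.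
Proof.
move=> v0.
have mgt u : measurable (Y @^-1` `]u, +oo[%classic).
  exact: (measurable_funPTI Y).
have pE : P [set w : T | v <= Y w] = (fine (P [set w : T | v <= Y w]))%:E.
  by rewrite fineK// fin_num_measure//; exact: measurable_ge.
have mge := measurable_ge v.
apply/eqP; rewrite eq_le; apply/andP; split; last first.
  rewrite /ccdf/= /distribution/pushforward.
  apply: le_measure; rewrite ?inE// => w /=.
  by rewrite in_itv/= andbT => /ltW.
rewrite pE ccdf_fineE lee_fin.
apply: (convex_left_limit_le Gc v0) => // y y0 yv.
rewrite -lee_fin -pE -ccdf_fineE /ccdf/= /distribution/pushforward.
apply: le_measure; rewrite ?inE// => w /=.
by rewrite in_itv/= andbT; exact: lt_le_trans.
Qed.

Lemma ccdf_lt_eventually v : 0 < G v -> exists2 z, v < z & G z < G v.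
Proof.
move=> Gv0.
have /fine_cvg := cvg_ccdfy0 Y; move/cvgr_lt => /(_ _ Gv0) H.
have [z [Gz vz]] := filter_ex (filterI H (nbhs_pinfty_gt (num_real v))).
by exists z.
Qed.

Hypothesis m2 : ('E_P[fun w : T => (Y w ^+ 2)%R] = 1)%E.

Let mGsqrt : measurable_fun setT (fun t : R => ccdf Y (Num.sqrt t)).
Proof.
apply: measurableT_comp; first exact: ccdf_measurable.
exact: measurable_sqrt.
Qed.

Let moment_bump a b e t0 t1 : 0 <= a -> 0 < b -> 0 <= e -> 0 <= t0 ->
  (forall t, 0 <= t ->
    a * tent b (Num.sqrt t) + e * \1_(`[t0, t1]) t <= G (Num.sqrt t)) ->
  a * (b ^+ 2 / 3) + e * (t1 - t0) <= 1.
Proof.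
move=> a0 b0 e0 t00 H.
rewrite -lee_fin -[X in (_ <= X)%E]m2.
apply: le_trans (expectation_sqr_ge Y).
apply: le_integral_tent_bump => // t t0'.
by rewrite ccdf_fineE lee_fin; exact: H.
Qed.

Lemma tent_below_moment a b : 0 <= a -> 0 < b ->
  (forall y, 0 <= y -> a * tent b y <= G y) -> a * b ^+ 2 <= 3.
Proof.
move=> a0 b0 H.
have := @moment_bump a b 0 0 0 a0 b0 (lexx _) (lexx _).
rewrite mul0r addr0 => h; suff : a * (b ^+ 2 / 3) <= 1 by lra.
by apply: h => t t0; rewrite mul0r addr0 H ?sqrtr_ge0.
Qed.

(** If the tent already uses up the second moment, the tail cannot exceed it
    at any point [y]: by right continuity an excess at [y] persists on some
    interval [[y, z]], as the tent decreases, and this adds a positive amount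
    to the second moment. *)
Lemma tent_below_eq a b : 0 <= a -> 0 < b ->
  (forall y, 0 <= y -> a * tent b y <= G y) -> a * b ^+ 2 = 3 ->
  forall y, 0 <= y -> ccdf Y y = (a * tent b y)%:E.
Proof.
move=> a0 b0 H ab y y0; rewrite ccdf_fineE; congr EFin.
apply/eqP; rewrite eq_le H// andbT leNgt; apply/negP => gap.
pose e := (G y - a * tent b y) / 2.
have e0 : 0 < e by rewrite divr_gt0// subr_gt0.
have /fine_cvg /cvgr_gt : ccdf Y u @[u --> y^'+] --> (G y)%:E.
  by rewrite -ccdf_fineE; exact: ccdf_right_continuous.
move=> /(_ (G y - e)); rewrite gtrBl => /(_ e0) near_y.
have [z [Gz yz]] : exists z, G y - e < G z /\ y < z.
  by apply: (@filter_ex _ (y^'+)); exact: filterI near_y (nbhs_right_gt y).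
have G_anti u w : u <= w -> G w <= G u.
  by move=> uw; rewrite -lee_fin -!ccdf_fineE ccdf_nonincreasing.
have z0 : 0 <= z := le_trans y0 (ltW yz).
have yz2 : y ^+ 2 < z ^+ 2 by rewrite ltr_pXn2r// nnegrE.
have := @moment_bump a b e (y ^+ 2) (z ^+ 2) a0 b0 (ltW e0) (sqr_ge0 _).
rewrite mulrA ab divff// => bd; suff : 1 + e * (z ^+ 2 - y ^+ 2) <= 1.
  by rewrite gerDl leNgt mulr_gt0// subr_gt0.
apply: bd => t t0; rewrite indicE; case: (boolP (t \in _)) => /=; last first.
  by move=> _; rewrite mulr0 addr0 H ?sqrtr_ge0.
rewrite inE/= in_itv/= => /andP[yt tz]; rewrite mulr1.
have sy : y <= Num.sqrt t by rewrite -(ger0_norm y0) -sqrtr_sqr ler_wsqrtr.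
have sz : Num.sqrt t <= z.
  by rewrite -(ger0_norm z0) -sqrtr_sqr ler_wsqrtr.
have := G_anti _ _ sz; have := tent_nonincreasing b0 sy.
move=> /(ler_wpM2l a0); rewrite /e in Gz *; lra.
Qed.

(** The supporting line of the tail at [v] has height [a] over [0] and
    vanishes at [b]; its positive part is the tent.  The bound [a <= 1] says
    that the line lies below the tail at [0]. *)
Lemma supporting_tent v : 0 < v -> 0 < G v -> exists a b,
  [/\ 0 < a <= 1, v < b, ccdf Y v = (a * (1 - v / b))%:E, a * b ^+ 2 <= 3 &
   a * b ^+ 2 = 3 -> forall y, 0 <= y -> ccdf Y y = (a * tent b y)%:E].
Proof.
move=> v0 Gv0; have [z vz Gz] := ccdf_lt_eventually Gv0.
have [m mpos line] := support_line Gc v0 vz Gz.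
pose a := G v + m * v; pose b := a / m.
have a0 : 0 < a by rewrite addr_gt0// mulr_gt0.
have b0 : 0 < b by rewrite divr_gt0.
have lineE y : a * (1 - y / b) = G v - m * (y - v).
  have -> : a * (1 - y / b) = a - m * y.
    by rewrite /b; field; rewrite !gt_eqF.
  by rewrite /a; ring.
have below y : 0 <= y -> a * tent b y <= G y.
  move=> y0; rewrite /tent maxr_pMr ?(ltW a0)// mulr0 ge_max G_ge0/=.
  by rewrite lineE line.
exists a, b; split.
- rewrite a0/=; apply: le_trans (G_le1 0).
  by have := line 0 (lexx _); rewrite -lineE mul0r subr0 mulr1.
- by rewrite /b ltr_pdivlMr// mulrC /a ltrDr.
- by rewrite lineE subrr mulr0 subr0 ccdf_fineE.
- exact: (tent_below_moment (ltW a0) b0 below).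
- exact: (tent_below_eq (ltW a0) b0 below).
Qed.

End tail.

(** * The inequality and its cases of equality *)

Theorem theorem4p1 (d : measure_display) (T : measurableType d) (R : realType)
    (P : probability T R) (Y : {RV P >-> R})
    (second_moment : ('E_P[fun w : T => (Y w ^+ 2)%R] = 1)%E)
    (cdf_concave : concave_function `[0, +oo[ (fun x : R => fine (cdf Y x)))
    (cdf_eq0 : forall x : R, x < 0 -> cdf Y x = 0%E) :
  [/\ forall v : R, 0 <= v -> v <= 2 / Num.sqrt 3 ->
        (P [set w : T | (v <= Y w)%R] <= (1 - v / Num.sqrt 3)%:E)%E,
      forall v : R, 2 / Num.sqrt 3 <= v ->
        (P [set w : T | (v <= Y w)%R] <= (4 / 9 * (1 / v ^+ 2))%:E)%E,
      forall v : R, 0 <= v -> v <= 2 / Num.sqrt 3 ->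
        (has_uniform_law Y (Num.sqrt 3) ->
           P [set w : T | v <= Y w] = (1 - v / Num.sqrt 3)%:E) /\
        (v != 0 -> P [set w : T | v <= Y w] = (1 - v / Num.sqrt 3)%:E ->
           has_uniform_law Y (Num.sqrt 3)) &
      forall v : R, 2 / Num.sqrt 3 <= v ->
        (P [set w : T | v <= Y w] = (4 / 9 * (1 / v ^+ 2))%:E <->
         has_boundary_inflated_uniform_law Y (3 * v / 2)
           (1 - 4 / (3 * v ^+ 2)))].
Proof.
set s := Num.sqrt 3.
have s0 : 0 < s by rewrite sqrtr_gt0; lra.
have s2 : s ^+ 2 = 3 by rewrite sqr_sqrtr//; lra.
have ls0 : 0 < 2 / s by rewrite divr_gt0.
have ls1 v : v <= 2 / s -> 0 < 1 - v / s.
  rewrite ler_pdivlMr// => vs.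
  have -> : 1 - v / s = 1 - v * s / 3 by rewrite -s2; field; rewrite gt_eqF.
  lra.
have PE v : 0 < v -> P [set w : T | v <= Y w] = ccdf Y v.
  move=> v0; exact: (tail_ccdf (ccdf_chord cdf_concave) v0).
(* When the tail vanishes at [v] there is no tent, but then the bounds hold
   strictly, so equality cannot occur. *)
have tent_or_null v : 0 < v -> ccdf Y v = 0%E \/ exists a b,
  [/\ 0 < a <= 1, v < b, ccdf Y v = (a * (1 - v / b))%:E, a * b ^+ 2 <= 3 &
   a * b ^+ 2 = 3 -> forall y, 0 <= y -> ccdf Y y = (a * tent b y)%:E].
  move=> v0; have [G0|G0] := eqVneq (fine (ccdf Y v)) 0.
    by left; rewrite ccdf_fineE G0.
  right; apply: (supporting_tent (ccdf_chord cdf_concave) second_moment v0).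
  by rewrite lt_neqAle eq_sym G0 fine_ge0.
have lawP v : P [set w : T | v <= Y w] = distribution P Y `[v, +oo[%classic.
  by rewrite set_ge_preimage.
split.
- move=> v v0 vs; have [->|vn0] := eqVneq v 0.
    by rewrite mul0r subr0; apply/probability_le1/measurable_ge.
  have {vn0}v0 : 0 < v by rewrite lt_neqAle eq_sym vn0.
  rewrite PE//.
  have [->|[a [b [/andP[a0 a1] vb -> ab _]]]] := tent_or_null v v0.
    by rewrite lee_fin ltW// ls1.
  by rewrite lee_fin (tent_value_le_linear s0 s2 a1 ab v0 vb vs).
- move=> v vs; have v0 : 0 < v by exact: lt_le_trans vs.
  rewrite PE//.
  have [->|[a [b [/andP[a0 a1] vb -> ab _]]]] := tent_or_null v v0.
    by rewrite lee_fin !mulr_ge0// invr_ge0 sqr_ge0.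
  by rewrite lee_fin (tent_value_le_inverse_square ab v0 vb).
- move=> v v0 vs; split.
    move=> [s0' law]; rewrite lawP law//.
    have s1 : v <= s.
      by have := ls1 v vs; rewrite subr_gt0 ltr_pdivrMr// mul1r => /ltW.
    by rewrite uniform_prob_cy.
  move=> vn0.
  have {vn0}v0 : 0 < v by rewrite lt_neqAle eq_sym vn0.
  rewrite PE//.
  have [->|[a [b [/andP[a0 a1] vb -> ab H]]]] := tent_or_null v v0.
    by move=> [] /esym /eqP; rewrite gt_eqF// ls1.
  move=> [] /eqP; rewrite (tent_value_le_linear s0 s2 a1 ab v0 vb vs).
  move=> /andP[/eqP aE /eqP bE]; exists s0 => A mA; move: H.
  rewrite aE bE s2 mul1r => /(_ erefl) H.
  rewrite (@boundary_inflated_of_ccdf _ _ _ _ Y s 1 s0 _ _ H A mA)//.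
    by rewrite subrr mul0e add0e mul1e.
  by rewrite ler01 lexx.
- move=> v vs; have v0 : 0 < v by exact: lt_le_trans vs.
  have p0 : 0 < 4 / (3 * v ^+ 2) by rewrite divr_gt0// mulr_gt0// exprn_gt0.
  have c0 : 0 < 3 * v / 2 by rewrite divr_gt0// mulr_gt0.
  have p1 : 4 / (3 * v ^+ 2) <= 1.
    rewrite ler_pdivrMr ?mulr_gt0 ?exprn_gt0// mul1r.
    have : (2 / s) ^+ 2 <= v ^+ 2 by rewrite lerXn2r// nnegrE ltW.
    by rewrite expr_div_n s2; lra.
  have pE : 1 - (1 - 4 / (3 * v ^+ 2)) = 4 / (3 * v ^+ 2) by ring.
  split.
    rewrite PE//.
    have [->|[a [b [/andP[a0 a1] vb -> ab H]]]] := tent_or_null v v0.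
      by move=> [] /esym /eqP; rewrite gt_eqF// !mulr_gt0// invr_gt0 exprn_gt0.
    move=> [] /eqP; rewrite (tent_value_le_inverse_square ab v0 vb).
    move=> /andP[/eqP a3 /eqP bE].
    have aE : a = 4 / (3 * v ^+ 2).
      apply: (@mulIf _ (b ^+ 2)); first by rewrite bE gt_eqF// exprn_gt0.
      by rewrite a3 bE; field; rewrite gt_eqF.
    split; first by lra.
    exists c0 => A mA; rewrite pE.
    apply: (boundary_inflated_of_ccdf c0 _ cdf_eq0 _ mA).
      by rewrite p1 ltW.
    by rewrite -aE -bE; exact: H.
  move=> [_ [c0' law]]; rewrite lawP law// uniform_prob_cy ?ltW//; last lra.
  rewrite diracE memNset ?mule0 ?add0e; last first.
    by rewrite /= in_itv/= andbT; apply/negP; rewrite -ltNge.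
  by rewrite pE -EFinM; congr EFin; field; rewrite gt_eqF.
Qed.
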